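(* Let $X$ be the Markov mixture process on $\mathbb{S}=E\cup\{\Delta\}$, let $\Gamma_1,\Gamma_2$ be stochastically closed subsets of $\mathbb{S}$ with $\Gamma_1\cap\Gamma_2=\{\Delta\}$, and $\tau_l=\inf\{t\ge0:X_t\in\Gamma_l\}$, $l=1,2$. The $\mathcal{F}_{t,i}$-conditional joint distribution $\overline F_{i,t}(t_1,t_2)=\mathbb{P}\{\tau_1>t_1,\tau_2>t_2\mid\mathcal{F}_{t,i}\}$ is given, for $t_1,t_2\ge t\ge0$ and $i\in E$, by $$\overline F_{i,t}(t_1,t_2)=\begin{cases}\sum_{k=1}^m\mathbf{e}_i^{\top}\mathbf{S}^{(k)}(t)e^{\mathbf{B}^{(k)}(t_2-t)}\mathbf{H}_2e^{\mathbf{B}^{(k)}(t_1-t_2)}\mathbf{H}_1\mathbb{1},&t_1\ge t_2\ge t\ge0,\\[4pt]\sum_{k=1}^m\mathbf{e}_i^{\top}\mathbf{S}^{(k)}(t)e^{\mathbf{B}^{(k)}(t_1-t)}\mathbf{H}_1e^{\mathbf{B}^{(k)}(t_2-t_1)}\mathbf{H}_2\mathbb{1},&t_2\ge t_1\ge t\ge0,\end{cases}$$ with $\sum_{k=1}^m\mathbf{S}^{(k)}(t)=\mathbf{I}$, where $\mathbf{H}_l$ is the $n\times n$ diagonal matrix whose $i$th diagonal element, $i\in E$, is $1$ if $i\in\Gamma_l^c$ and $0$ otherwise.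
   Context: Mixture process: $E=\{1,\dots,n\}$ are the transient states, $\Delta=n+1$ is the absorbing state, $\mathbb{S}=E\cup\{\Delta\}$. For $k=1,\dots,m$, $\mathbf{Q}^{(k)}=\begin{pmatrix}\mathbf{B}^{(k)}&-\mathbf{B}^{(k)}\mathbb{1}\\ \mathbf{0}&0\end{pmatrix}$ is an intensity matrix on $\mathbb{S}$ (nonnegative off-diagonal entries, zero row sums) with $\mathbf{B}^{(k)}$ an $n\times n$ nonsingular matrix. On a probability space there are an unobserved regime $\phi\in\{1,\dots,m\}$ and an $\mathbb{S}$-valued right-continuous process $X=(X_t)_{t\ge0}$ such that $\mathbb{P}\{X_0=i\}=\pi_i$ for $i\in E$, $\mathbb{P}\{X_0=\Delta\}=0$, $\mathbb{P}\{\phi=k\mid X_0=i\}=s_i^{(k)}$ with $\sum_k s_i^{(k)}=1$, and, given $\phi=k$ and $X_0=i$, $X$ is a time-homogeneous Markov jump process with intensity matrix $\mathbf{Q}^{(k)}$ started at $i$. Closed sets: $\Gamma_l$ stochastically closed means $[\mathbf{Q}^{(k)}]_{i,j}=0$ for all $k$ whenever $i\in\Gamma_l$, $j\in\Gamma_l^c$ (once $X$ enters $\Gamma_l$ it never leaves). It is assumed that $\pi_i\ne0$ for $i\in\Gamma_1^c\cap\Gamma_2^c$ and $\mathbb{P}\{\tau_1>0,\tau_2>0\}=1$. Information: $\mathcal{F}_{t-}$ is any sub-$\sigma$-field of $\sigma(X_s:0\le s<t)$ (full, partial, or no information). $\mathcal{F}_{t,i}$ denotes $\mathcal{F}_{t-}$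 together with $X_t=i$: $\mathbb{P}\{A\mid\mathcal{F}_{t,i}\}:=\mathbb{P}\{A\cap\{X_t=i\}\mid\mathcal{F}_{t-}\}/\mathbb{P}\{X_t=i\mid\mathcal{F}_{t-}\}$ where the denominator is positive; identities are almost sure there. $\mathbf{S}^{(k)}(t)=\mathrm{diag}(s_1^{(k)}(t),\dots,s_n^{(k)}(t))$ with $s_i^{(k)}(t)=\mathbb{P}\{\phi=k\mid\mathcal{F}_{t,i}\}$ (completed arbitrarily to nonnegative weights summing to $1$ over $k$ where undefined). $\mathbf{e}_i$ is the $i$th unit vector, $\mathbb{1}$ the all-ones vector. *)

(* Defs.v *)
From HB Require Import structures.
From mathcomp Require Import all_boot all_order all_algebra.
From mathcomp Require Import all_classical all_reals all_analysis.
Import Order.TTheory GRing.Theory Num.Theory.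
Import numFieldNormedType.Exports.

Set Implicit Arguments.
Unset Strict Implicit.
Unset Printing Implicit Defensive.

Local Open Scope classical_set_scope.
Local Open Scope ring_scope.

Section MatrixExponential.
Context {R : realType} {n : nat}.

(* Entrywise sum of the exponential series; it converges for every A. *)
Definition expmx (A : 'M[R]_n) : 'M[R]_n :=
  \matrix_(i, j) limn (series (fun l : nat => (A ^+ l) i j / (l`!)%:R)).

End MatrixExponential.

Section StateSpace.
Context {R : realType} {n : nat}.

(* The states are 'I_(n + 1): the transient ones are the images of 'I_n under
   lshift, so that block matrices are indexed by states. *)
Definition transient (i : 'I_n) : 'I_(n + 1) := lshift 1 i.
Definition absorbing : 'I_(n + 1) := rshift n ord0.

Definition intensity_of (B : 'M[R]_n) : 'M[R]_(n + 1) :=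
  block_mx B (- (B *m const_mx 1)) 0 0.

Definition is_intensity (Q : 'M[R]_(n + 1)) : Prop :=
  (forall i j, i != j -> 0 <= Q i j) /\ (forall i, \sum_j Q i j = 0).

Definition stochastically_closed {m : nat} (Q : 'I_m -> 'M[R]_(n + 1))
    (G : {set 'I_(n + 1)}) : Prop :=
  forall (k : 'I_m) i j, i \in G -> j \notin G -> Q k i j = 0.

Definition survival_mx (G : {set 'I_(n + 1)}) : 'M[R]_n :=
  diag_mx (\row_i (transient i \notin G)%:R).

(* Standard stochastic semigroup on [0, +oo[ whose right derivative at 0 is the
   intensity matrix Q. *)
Definition transition_semigroup (Q : 'M[R]_(n + 1))
    (p : R -> 'M[R]_(n + 1)) : Prop :=
  [/\ (forall t, 0 <= t ->
         (forall i j, 0 <= p t i j) /\ (forall i, \sum_j p t i j = 1)),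
      p 0 = 1%:M,
      (forall s t, 0 <= s -> 0 <= t -> p (s + t) = p s *m p t) &
      (forall i j, (p h i j - (1%:M : 'M[R]_(n + 1)) i j) / h
                     @[h --> 0^'+] --> Q i j)].

End StateSpace.

Section Process.
Context {R : realType} {d : measure_display} {Omega : measurableType d}.
Context {n : nat}.
Implicit Types (X : R -> Omega -> 'I_(n + 1)).

Definition at_state X (t : R) (x : 'I_(n + 1)) : set Omega :=
  [set w | X t w = x].

Definition sigma_of X (I : set R) : set (set Omega) :=
  <<s [set A | exists2 s, I s & exists x, A = at_state X s x] >>.

(* Right-continuity for the discrete topology on the state space. *)
Definition right_continuous_paths X : Prop :=
  forall (w : Omega) (t : R), 0 <= t -> \forall s \near t^'+, X s w = X t w.

(* +oo if G is never entered. *)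
Definition hitting_time X (G : {set 'I_(n + 1)}) (w : Omega) : \bar R :=
  ereal_inf [set t%:E | t in [set t : R | 0 <= t /\ X t w \in G]].

Definition joint_survival X (G1 G2 : {set 'I_(n + 1)}) (t1 t2 : R) : set Omega :=
  [set w | (t1%:E < hitting_time X G1 w)%E /\ (t2%:E < hitting_time X G2 w)%E].

(* Elementary conditional probability, meaningful when P D is nonzero. *)
Definition prob_given (P : probability Omega R) (D A : set Omega) : R :=
  fine (P (A `&` D)) / fine (P D).

(* Under the set function Pr, X is a time-homogeneous Markov process for its
   natural filtration, started at x0, with intensity matrix Q; the Markov
   property Pr (X_(s+h) = y | sigma(X_r, r <= s)) = p_h(X_s, y) is integrated
   over the events of the past. *)
Definition markov_jump_process (Pr : set Omega -> R) X
    (Q : 'M[R]_(n + 1)) (x0 : 'I_(n + 1)) : Prop :=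
  Pr (at_state X 0 x0) = 1 /\
  exists2 p : R -> 'M[R]_(n + 1), transition_semigroup Q p &
    forall (s h : R) (x y : 'I_(n + 1)) (A : set Omega),
      0 <= s -> 0 <= h -> sigma_of X `[0, s] A ->
      Pr (A `&` at_state X s x `&` at_state X (s + h) y) =
      Pr (A `&` at_state X s x) * p h x y.

End Process.

Section ConditionalProbability.
Context {R : realType} {d : measure_display} {Omega : measurableType d}.
Implicit Types (P : probability Omega R) (F : set (set Omega)).

(* g is a version of P{A | F}. *)
Definition is_cond_prob P F (A : set Omega) (g : Omega -> R) : Prop :=
  [/\ (forall Y : set R, measurable Y -> F (g @^-1` Y)),
      P.-integrable setT (EFin \o g) &
      (forall C, F C -> (\int[P]_(w in C) (g w)%:E)%E = P (A `&` C))].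

(* f is a version of P{A | F, D} := P{A /\ D | F} / P{D | F}, where q is a given
   version of P{D | F}; f is unconstrained where q is not positive. *)
Definition is_cond_prob_on P F (D : set Omega) (q : Omega -> R)
    (A : set Omega) (f : Omega -> R) : Prop :=
  exists2 a : Omega -> R, is_cond_prob P F (A `&` D) a &
    {ae P, forall w, 0 < q w -> f w = a w / q w}.

End ConditionalProbability.

Section Mixture.
Context {R : realType} {d : measure_display} {Omega : measurableType d}.
Context {n m : nat}.

(* s k i is only determined by P where the initial probability of i is
   nonzero. *)
Record markov_mixture (P : probability Omega R) (X : R -> Omega -> 'I_(n + 1))
    (phi : Omega -> 'I_m) (pi : 'I_n -> R) (s : 'I_m -> 'I_n -> R)
    (Q : 'I_m -> 'M[R]_(n + 1)) : Prop := MarkovMixture {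
  mixture_measurable_state : forall t x, 0 <= t -> measurable (at_state X t x) ;
  mixture_measurable_regime : forall k, measurable [set w | phi w = k] ;
  mixture_right_continuous : right_continuous_paths X ;
  mixture_init : forall i, P (at_state X 0 (transient i)) = (pi i)%:E ;
  mixture_init_absorbing : P (at_state X 0 absorbing) = 0%E ;
  mixture_weight_ge0 : forall k i, 0 <= s k i ;
  mixture_weight_sum : forall i, \sum_k s k i = 1 ;
  mixture_weight : forall k i, pi i != 0 ->
    prob_given P (at_state X 0 (transient i)) [set w | phi w = k] = s k i ;
  mixture_markov : forall k i,
    let D := [set w | phi w = k] `&` at_state X 0 (transient i) in
    P D != 0%E ->
    markov_jump_process (prob_given P D) X (Q k) (transient i)
}.

End Mixture.

(* Main.v *)
Require Import Defs.
From HB Require Import structures.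
From mathcomp Require Import all_boot all_order all_algebra.
From mathcomp Require Import all_classical all_reals all_analysis.
From mathcomp Require Import measurable_realfun ring.
Import Order.TTheory GRing.Theory Num.Theory.
Import numFieldNormedType.Exports.
Local Open Scope classical_set_scope.
Local Open Scope ring_scope.

(* Given the regime k, the transition functions are e^{hQ_k}: the forward
   equation p' = pQ bounds the remainder of p against the truncated exponential
   series by (Kt)^L / L!.  A closed set is almost surely never left, so by
   right-continuity {tau > t} and {X_t not in Gamma} differ by a null set, and
   the joint survival event becomes an event about X at the two times only.  The
   Markov property under each regime then gives, for every C in F_t,
     P(survival, X_t = i, C) = sum_k P(phi = k, X_t = i, C) v_k,
   where v_k is the matrix expression; integrating over the sets of F_t where the
   difference of the two F_t-measurable versions has a given sign shows that it
   vanishes almost surely. *)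

(** * Derivative comparison and truncated exponential sums *)

(** The difference [g - f] is nondecreasing on [0, T]. At 0 only right limits are asked, because a
    transition semigroup is constrained at nonnegative times only. *)
Lemma ler_of_derivative {R : realType} (f df g dg : R -> R) (T : R) :
  0 < T -> f 0 <= g 0 ->
  (forall x : R, 0 < x -> is_derive x 1 f (df x)) ->
  (forall x : R, 0 < x -> is_derive x 1 g (dg x)) ->
  f x @[x --> 0^'+] --> f 0 -> g x @[x --> 0^'+] --> g 0 ->
  (forall x : R, 0 < x -> df x <= dg x) -> f T <= g T.
Proof.
move=> T0 fg0 Df Dg cf cg dfg.
have Dh (x : R) : 0 < x -> is_derive x 1 (g - f) (dg x - df x).
  by move=> x0; have ? := Df _ x0; have ? := Dg _ x0; exact: is_deriveB.
have ch (x : R) : 0 < x -> {for x, continuous (g - f)}.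
  by move=> /Dh Dx; apply/differentiable_continuous/derivable1_diffP; case: Dx.
suff : (g - f) 0 <= (g - f) T.
  rewrite !fctE => gf; rewrite -subr_ge0; apply: le_trans gf.
  by rewrite subr_ge0.
apply: (@ger0_derive1_le_cc _ (g - f) 0 T).
- by move=> x; rewrite in_itv/= => /andP[/Dh[]].
- move=> x; rewrite in_itv/= => /andP[x0 _]; rewrite derive1E.
  by have [_ ->] := Dh _ x0; rewrite subr_ge0 dfg.
- apply/(continuous_within_itvP _ T0); split.
  + by move=> x; rewrite in_itv/= => /andP[x0 _]; exact: ch.
  + exact: cvgB.
  + exact/cvg_at_left_filter/ch.
- by rewrite in_itv/= lexx ltW.
- by rewrite in_itv/= lexx ltW.
- exact: ltW.
Qed.

Lemma is_derive_exp_monomial {R : realType} (c t : R) l :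
  is_derive t 1 (fun u : R => u ^+ l.+1 / l.+1`!%:R * c) (t ^+ l / l`!%:R * c).
Proof.
rewrite (_ : (fun _ => _) = (c / l.+1`!%:R) *: (@id R ^+ l.+1)); last first.
  by apply/funext => u; rewrite -[RHS]/(_ * (@id R ^+ l.+1) u) fctE mulrC mulrA mulrAC.
apply: is_derive_eq; rewrite -[_ *: (_ *: _)]/(_ * (_ * _)) mulr1 factS natrM.
by rewrite invfM; field; rewrite nat1r !pnatr_eq0 -lt0n fact_gt0.
Qed.

(** Differentiation drops one term and shifts the coefficients; with [c l] an entry of [Q ^+ l], the
    shift is a multiplication by [Q]. *)
Lemma is_derive_exp_sum {R : realType} (c : nat -> R) (t : R) L :
  is_derive t 1 (fun u : R => \sum_(l < L.+1) u ^+ l / l`!%:R * c l)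
    (\sum_(l < L) t ^+ l / l`!%:R * c l.+1).
Proof.
elim: L => [|L IH].
  rewrite big_ord0 (_ : (fun _ => _) = cst (c 0%N)); first exact: is_derive_cst.
  by apply/funext => u; rewrite big_ord1 expr0 fact0 divr1 mul1r.
rewrite big_ord_recr/= (_ : (fun _ => _) =
  (fun u : R => \sum_(l < L.+1) u ^+ l / l`!%:R * c l) +
  (fun u : R => u ^+ L.+1 / L.+1`!%:R * c L.+1)).
  by have ? := is_derive_exp_monomial (c L.+1) t L; exact: is_deriveD.
by apply/funext => u; rewrite big_ord_recr.
Qed.

Lemma mul_entry {R : realType} {N : nat} (A C : 'M[R]_N) i j :
  (A *m C) i j = \sum_k A i k * C k j.
Proof. by rewrite mxE. Qed.

(* The library states exprZn for unital algebras, which requires a nonzero size. *)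
Lemma exprZmx {R : comNzRingType} {N : nat} (a : R) (A : 'M[R]_N) l :
  (a *: A) ^+ l = a ^+ l *: A ^+ l.
Proof.
elim: l => [|l IH]; first by rewrite !expr0 scale1r.
by rewrite !exprS IH -[LHS]scalemxAl -scalemxAr scalerA.
Qed.

(** * Transition semigroups are matrix exponentials *)

Section SemigroupExponential.
Context {R : realType} {n : nat}.
Variables (Q : 'M[R]_(n + 1)) (p : R -> 'M[R]_(n + 1)).
Hypothesis semigroup_p : transition_semigroup Q p.

Let p_ge0 (t : R) i j : 0 <= t -> 0 <= p t i j.
Proof. by move=> t0; case: semigroup_p => /(_ _ t0)[]. Qed.

Let p_le1 (t : R) i j : 0 <= t -> p t i j <= 1.
Proof.
move=> t0; case: semigroup_p => /(_ _ t0)[_ /(_ i) <-] _ _ _.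
by rewrite (bigD1 j)//= lerDl sumr_ge0// => k _; exact: p_ge0.
Qed.

Let p_norm (t : R) i j : 0 <= t -> `|p t i j| <= 1.
Proof. by move=> t0; rewrite ger0_norm ?p_le1 ?p_ge0. Qed.

Let p0 : p 0 = 1%:M.
Proof. by case: semigroup_p. Qed.

Let pD (s t : R) : 0 <= s -> 0 <= t -> p (s + t) = p s *m p t.
Proof. by case: semigroup_p => _ _ + _; exact. Qed.

Let quotient i j : (p h i j - (1%:M : 'M[R]_(n + 1)) i j) / h
  @[h --> 0^'+] --> Q i j.
Proof. by case: semigroup_p. Qed.

Let increment_cvg0 i j :
  p h i j - (1%:M : 'M[R]_(n + 1)) i j @[h --> 0^'+] --> (0 : R).
Proof.
have h0 : h @[h --> (0:R)^'+] --> (0 : R) by exact/cvg_at_right_filter/cvg_id.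
rewrite -[X in _ --> X](mulr0 (Q i j)).
apply: cvg_trans (cvgM (quotient i j) h0); apply: near_eq_cvg.
by near=> h; rewrite /= divfK// gt_eqF//; near: h; exact: nbhs_right_gt.
Unshelve. all: by end_near. Qed.

Let increment (s h : R) i j : 0 <= s -> 0 <= h ->
  p (s + h) i j - p s i j =
  \sum_k p s i k * (p h k j - (1%:M : 'M[R]_(n + 1)) k j).
Proof.
move=> s0 h0; rewrite pD// -[in X in _ - X](mulmx1 (p s)) !mul_entry.
by rewrite -sumrB; apply: eq_bigr => k _; rewrite mulrBr.
Qed.

Let sum_cvg (J : finType) (F : J -> R -> R) (l : J -> R) :
  (forall k, F k h @[h --> 0^'+] --> l k) ->
  \sum_k F k h @[h --> 0^'+] --> \sum_k l k.
Proof. by move=> Fl; apply: cvg_big => // *; exact: add_continuous. Qed.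

(* Left continuity: p_t - p_(t-h) = p_(t-h) (p_h - 1) and p_(t-h) is stochastic. *)
Let backward_cvg (t : R) i j : 0 < t -> p (t - h) i j @[h --> 0^'+] --> p t i j.
Proof.
move=> t0; apply/subr_cvg0; apply: (@norm_cvg0 _ R^o).
pose S h := \sum_k `|p h k j - (1%:M : 'M[R]_(n + 1)) k j|.
have S0 : S h @[h --> 0^'+] --> (0 : R).
  rewrite [X in _ --> X](_ : _ = \sum_(k < n + 1) (0 : R)); last by rewrite big1.
  by apply: sum_cvg => k; rewrite -[X in _ --> X](normr0 R); apply: (@cvg_norm _ R^o); exact: increment_cvg0.
have bnd : \forall h \near (0 : R)^'+, 0 <= `|p (t - h) i j - p t i j| <= S h.
  near=> h; have h0 : 0 < h by near: h; exact: nbhs_right_gt.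
  have ht : h <= t by near: h; exact: nbhs_right_le.
  rewrite normr_ge0/= distrC -{1}(subrK h t) increment ?subr_ge0// ?(ltW h0)//.
  apply: le_trans (ler_norm_sum _ _ _) _; apply: ler_sum => k _.
  by rewrite normrM ler_piMl// p_norm// subr_ge0.
by apply: (squeeze_cvgr bnd _ S0); exact: cvg_cst.
Unshelve. all: by end_near. Qed.

(** Forward equation. The right quotient at t is p_t (p_h - 1)/h and the left one is p_(t-h) (p_h -
    1)/h; both tend to p_t Q, the latter by left continuity. *)
Lemma semigroup_is_derive (t : R) i j :
  0 < t -> is_derive t 1 (fun u => p u i j) ((p t *m Q) i j).
Proof.
move=> t0.
suff H : h^-1 *: (p (h *: 1 + t) i j - p t i j) @[h --> 0^'] --> (p t *m Q) i j.
  split; first by apply/cvg_ex; exists ((p t *m Q) i j).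
  exact: cvg_lim.
rewrite mul_entry; apply: (@cvg_at_right_left_dnbhs _ R^o).
- apply: cvg_trans; last first.
    apply: (@sum_cvg _ (fun k h => p t i k *
      ((p h k j - (1%:M : 'M[R]_(n + 1)) k j) / h))) => k.
    by apply: cvgM; [exact: cvg_cst|exact: quotient].
  apply: near_eq_cvg; near=> h.
  have h0 : 0 < h by near: h; exact: nbhs_right_gt.
  rewrite -[h *: 1]/(h * 1) mulr1 [h + t]addrC increment ?(ltW h0) ?(ltW t0)// -[_ *: _]/(_ * _).
  by rewrite mulr_sumr; apply: eq_bigr => k _; rewrite mulrA mulrC.
(* Replacing h by -h turns the left limit into a right limit. *)
- apply/cvg_at_leftNP; rewrite oppr0; apply: cvg_trans; last first.
    apply: (@sum_cvg _ (fun k h => p (t - h) i k *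
      ((p h k j - (1%:M : 'M[R]_(n + 1)) k j) / h))) => k.
    by apply: cvgM; [exact: backward_cvg|exact: quotient].
  apply: near_eq_cvg; near=> h.
  have h0 : 0 < h by near: h; exact: nbhs_right_gt.
  have ht : h <= t by near: h; exact: nbhs_right_le.
  rewrite /= -[- h *: 1]/(- h * 1) mulr1 [- h + t]addrC -[_ *: _]/(_ * _).
  rewrite invrN mulNr -mulrN opprB -{2}(subrK h t) increment ?subr_ge0 ?(ltW h0)//.
  by rewrite mulr_sumr; apply: eq_bigr => k _; rewrite mulrA mulrC.
Unshelve. all: by end_near. Qed.

Lemma semigroup_right_continuous0 i j :
  p h i j @[h --> 0^'+] --> p 0 i j.
Proof. by rewrite p0; exact/subr_cvg0/increment_cvg0. Qed.

(** A crude norm of [Q]: it dominates every absolute column sum, so right multiplication by [Q]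
    enlarges a uniform bound on entries by at most the factor [K]. *)
Let K := \sum_k \sum_j `|Q k j|.

Let col_le j : \sum_k `|Q k j| <= K.
Proof. by apply: ler_sum => k _; rewrite (bigD1 j)//= lerDl sumr_ge0. Qed.

Let K_ge0 : 0 <= K.
Proof. by apply: sumr_ge0 => k _; exact: sumr_ge0. Qed.

(** [L] counts the terms: [taylor 0] is zero, so the remainder bound starts from |p| <= 1. *)
Let taylor L t i j : R := \sum_(l < L) t ^+ l / l`!%:R * (Q ^+ l) i j.

Let taylorS L t i j : \sum_(l < L) t ^+ l / l`!%:R * (Q ^+ l.+1) i j =
  \sum_k taylor L t i k * Q k j.
Proof.
under [RHS]eq_bigr do rewrite mulr_suml.
rewrite exchange_big/=; apply: eq_bigr => l _.
rewrite exprSr mul_entry mulr_sumr; apply: eq_bigr => k _.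
by rewrite mulrA.
Qed.

Let taylor0 L i j : taylor L.+1 0 i j = p 0 i j.
Proof.
rewrite p0 /taylor big_ord_recl expr0 fact0 divr1 mul1r expr0 big1 ?addr0// => l _.
by rewrite exprS !mul0r.
Qed.

(** Induction on [L]: the derivative of p - [taylor L.+1] is (p - [taylor L]) Q, which the induction
    hypothesis bounds by the derivative of the next bound. *)
Lemma semigroup_remainder L (t : R) i j : 0 <= t ->
  `|p t i j - taylor L t i j| <= t ^+ L / L`!%:R * K ^+ L.
Proof.
elim: L t i j => [|L IH] t i j t0.
  by rewrite /taylor big_ord0 subr0 !expr0 fact0 divr1 mulr1 p_norm.
move: t0; rewrite le_eqVlt => /predU1P[<-|t0].
  by rewrite taylor0 subrr normr0 exprS !mul0r.
have Dp (x : R) : 0 < x -> is_derive x 1 (fun u => p u i j) ((p x *m Q) i j).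
  exact: semigroup_is_derive.
have Dt (x : R) : is_derive x 1 (fun u => taylor L.+1 u i j)
    (\sum_k taylor L x i k * Q k j).
  by rewrite -taylorS; exact: (is_derive_exp_sum (fun l => (Q ^+ l) i j)).
have Dg x := is_derive_exp_monomial (K ^+ L.+1) x L.
have cont (f : R -> R) df : is_derive (0 : R) 1 f df ->
    f x @[x --> 0^'+] --> f 0.
  move=> [Df _]; apply/cvg_at_right_filter.
  exact/differentiable_continuous/derivable1_diffP.
have Dr (x : R) : 0 < x -> `|(p x *m Q) i j - \sum_k taylor L x i k * Q k j| <=
    x ^+ L / L`!%:R * K ^+ L.+1.
  move=> x0; rewrite mul_entry -sumrB.
  apply: le_trans (ler_norm_sum _ _ _) _.
  apply: (@le_trans _ _ (x ^+ L / L`!%:R * K ^+ L * \sum_k `|Q k j|)).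
    rewrite mulr_sumr; apply: ler_sum => k _; rewrite -mulrBl normrM.
    by rewrite ler_wpM2r// IH// ltW.
  rewrite exprSr mulrA ler_wpM2l//.
  by rewrite !mulr_ge0 ?exprn_ge0 ?invr_ge0 ?ler0n// ltW.
have g0 : (0 : R) ^+ L.+1 / L.+1`!%:R * K ^+ L.+1 = 0 by rewrite exprS !mul0r.
have cp := semigroup_right_continuous0 i j.
have ct := cont _ _ (Dt 0).
have cg := cont _ _ (Dg 0).
have DtS (x : R) : 0 < x -> is_derive x 1 (fun u => taylor L.+1 u i j)
    (\sum_k taylor L x i k * Q k j) by move=> _; exact: Dt.
have Dpg (x : R) : 0 < x -> is_derive x 1
    ((fun u => p u i j) + (fun u => u ^+ L.+1 / L.+1`!%:R * K ^+ L.+1))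
    ((p x *m Q) i j + x ^+ L / L`!%:R * K ^+ L.+1).
  by move=> /Dp ?; have ? := Dg x; exact: is_deriveD.
have Dtg (x : R) : 0 < x -> is_derive x 1
    ((fun u => taylor L.+1 u i j) + (fun u => u ^+ L.+1 / L.+1`!%:R * K ^+ L.+1))
    (\sum_k taylor L x i k * Q k j + x ^+ L / L`!%:R * K ^+ L.+1).
  by move=> _; have ? := Dg x; have ? := Dt x; exact: is_deriveD.
(* With g the claimed bound, taylor <= p + g and p <= taylor + g are two separate derivative
   comparisons. *)
rewrite ler_norml; apply/andP; split.
- rewrite lerNl opprB lerBlDl.
  refine (ler_of_derivative _ _ _ _ t t0 _ DtS Dpg ct (cvgD cp cg) _).
  + by rewrite taylor0 fctE g0 addr0.
  + by move=> x /Dr; rewrite ler_norml => /andP[+ _]; rewrite lerNl opprB lerBlDl.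
- rewrite lerBlDl.
  refine (ler_of_derivative _ _ _ _ t t0 _ Dp Dtg cp (cvgD ct cg) _).
  + by rewrite fctE taylor0 g0 addr0.
  + by move=> x /Dr; rewrite ler_norml => /andP[_]; rewrite lerBlDl.
Qed.

(** The remainder bound is the general term of the convergent series of exp(tK), hence tends to
    0. *)
Lemma expmx_partial_sums (t : R) i j : 0 <= t ->
  series (fun l => ((t *: Q) ^+ l) i j / l`!%:R) @ \oo --> p t i j.
Proof.
move=> t0.
have eqT : series (fun l => ((t *: Q) ^+ l) i j / l`!%:R) =
    (fun L => taylor L t i j).
  apply/funext => L; rewrite /series/= big_mkord; apply: eq_bigr => l _.
  by rewrite exprZmx mxE mulrAC.
rewrite eqT; apply/subr_cvg0; apply: (@norm_cvg0 _ R^o).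
have bnd : \forall L \near \oo, 0 <= `|taylor L t i j - p t i j| <= exp_coeff (t * K) L.
  near=> L; rewrite normr_ge0 distrC /exp_coeff/= exprMn mulrAC.
  exact: semigroup_remainder.
by apply: (squeeze_cvgr bnd); [exact: cvg_cst|exact: cvg_exp_coeff].
Unshelve. all: by end_near. Qed.

Lemma semigroup_expmx (t : R) : 0 <= t -> p t = expmx (t *: Q).
Proof.
move=> t0; apply/matrixP => i j; rewrite mxE.
by apply/esym/cvg_lim; [exact: Rhausdorff|exact: expmx_partial_sums].
Qed.

End SemigroupExponential.

(** * Exponentials of block matrices and closed sets *)

(** The induction also carries the vanishing of the lower left block, which keeps [C] out of the
    upper left one. *)
Lemma ulsubmx_exp_block {R : comNzRingType} {n1 n2 : nat} (B : 'M[R]_n1)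
    (C : 'M[R]_(n1, n2)) l :
  ulsubmx ((block_mx B C 0 0 : 'M[R]_(n1 + n2)) ^+ l) = B ^+ l.
Proof.
suff [//] : ulsubmx ((block_mx B C 0 0 : 'M[R]_(n1 + n2)) ^+ l) = B ^+ l /\
  dlsubmx ((block_mx B C 0 0 : 'M[R]_(n1 + n2)) ^+ l) = 0.
elim: l => [|l [IHu IHd]].
  by rewrite !expr0 -[1]/(1%:M) scalar_mx_block block_mxKul block_mxKdl.
rewrite exprS -[_ * _]/(_ *m _) -[_ ^+ l]submxK IHu IHd mulmx_block.
by rewrite block_mxKul block_mxKdl !mul0mx !mulmx0 !addr0 exprS.
Qed.

Lemma expmx_intensity_of {R : realType} {n : nat} (B : 'M[R]_n) (t : R) i j :
  expmx (t *: intensity_of B) (transient i) (transient j) = expmx (t *: B) i j.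
Proof.
rewrite !mxE; congr (limn (series _)); apply/funext => l; congr (_ / _).
by rewrite !exprZmx !mxE -(@ulsubmx_exp_block _ n 1 B (- (B *m const_mx 1)) l) !mxE.
Qed.

(** Every power of [Q] inherits the zero pattern: an intermediate state in [G] kills the second
    factor of the product, one outside [G] the first. *)
Lemma expmx_closed {R : realType} {N : nat} (Q : 'M[R]_N) (G : {set 'I_N}) (t : R) i j :
  (forall i j, i \in G -> j \notin G -> Q i j = 0) ->
  i \in G -> j \notin G -> expmx (t *: Q) i j = 0.
Proof.
move=> QG iG jG; have powG l i' j' : i' \in G -> j' \notin G -> (Q ^+ l) i' j' = 0.
  elim: l i' j' => [|l IH] i' j' iG' jG'.
    rewrite expr0 -[1]/(1%:M) mxE; case: eqVneq => // ij.
    by rewrite ij (negbTE jG') in iG'.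
  rewrite exprS mul_entry big1// => k _; case: (boolP (k \in G)) => kG.
    by rewrite (IH k)// mulr0.
  by rewrite (QG i')// mul0r.
rewrite mxE (_ : series _ = cst 0); first exact: lim_cst.
apply/funext => L; rewrite /series/= big1// => l _.
by rewrite exprZmx mxE powG// mulr0 mul0r.
Qed.

(** * The Markov property and hitting times under each regime *)

Section FiniteProbability.
Context {R : realType} {d : measure_display} {Omega : measurableType d}.
Variable P : probability Omega R.

Lemma probability_fineK (A : set Omega) : measurable A -> (fine (P A))%:E = P A.
Proof. by move=> mA; rewrite fineK// fin_num_measure. Qed.

Lemma null_subset (A N : set Omega) :
  measurable A -> measurable N -> P N = 0%E -> A `<=` N -> fine (P A) = 0.
Proof. by move=> mA mN N0 /subset_measure0 ->. Qed.

Lemma total_probability {N : nat} (f : Omega -> 'I_N) (E : set Omega) :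
  measurable E -> (forall x, measurable [set w | f w = x]) ->
  fine (P E) = \sum_x fine (P (E `&` [set w | f w = x])).
Proof.
move=> mE mf; pose F x := E `&` [set w | f w = x].
have mF x : measurable (F x) by exact: measurableI.
have EF : E = \bigcup_(x in [set` index_enum 'I_N]) F x.
  apply/seteqP; split => [w Ew|w [x _ []]//]; exists (f w) => //.
  exact: mem_index_enum.
rewrite sum_fine => [|x _]; last exact: fin_num_measure (mF x).
rewrite [in LHS]EF measure_fin_bigcup// -?fsbig_seq ?index_enum_uniq//.
by move=> x y _ _ [w [[_ <-] [_ <-]]].
Qed.

End FiniteProbability.

Section Regimes.
Context {R : realType} {d : measure_display} {Omega : measurableType d}.
Context {n m : nat}.
Variables (P : probability Omega R) (X : R -> Omega -> 'I_(n + 1)).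
Variables (phi : Omega -> 'I_m) (pi : 'I_n -> R) (s0 : 'I_m -> 'I_n -> R).
Variable Q : 'I_m -> 'M[R]_(n + 1).
Hypothesis X_mixture : markov_mixture P X phi pi s0 Q.

Let regime k : set Omega := [set w | phi w = k].

Let mX (t : R) x : 0 <= t -> measurable (at_state X t x).
Proof. by move=> t0; exact: mixture_measurable_state X_mixture _ _ t0. Qed.

Let mphi k : measurable (regime k).
Proof. exact: mixture_measurable_regime X_mixture k. Qed.

Lemma past_measurable (I : set R) : (forall u, I u -> 0 <= u) ->
  sigma_of X I `<=` measurable.
Proof.
move=> I0; apply: smallest_sub; first exact: sigma_algebra_measurable.
by move=> _ [u /I0 u0 [x ->]]; exact: mX.
Qed.

Lemma past_le (I J : set R) : I `<=` J -> sigma_of X I `<=` sigma_of X J.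
Proof.
move=> IJ; apply: sub_sigma_algebra2 => _ [u Iu [x ->]].
by exists u; [exact: IJ|exists x].
Qed.

Let closed_past_measurable (s : R) A : sigma_of X `[0, s] A -> measurable A.
Proof.
by apply: past_measurable => u /=; rewrite in_itv/= => /andP[].
Qed.

(** The Markov property is assumed given the regime and the initial state. Since e^{hQ_k} does not
    depend on the initial state, clearing denominators and summing over initial states leaves the
    regime alone. *)
Lemma regime_markov k (s h : R) x y A : 0 <= s -> 0 <= h ->
  sigma_of X `[0, s] A ->
  fine (P (A `&` at_state X s x `&` at_state X (s + h) y `&` regime k)) =
  fine (P (A `&` at_state X s x `&` regime k)) * expmx (h *: Q k) x y.
Proof.
move=> s_ge0 h_ge0 pastA; have mA := closed_past_measurable _ _ pastA.
have mAx : measurable (A `&` at_state X s x) by apply: measurableI => //; exact: mX.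
have mAxy : measurable (A `&` at_state X s x `&` at_state X (s + h) y).
  by apply: measurableI => //; apply: mX; exact: addr_ge0.
have mX0 i : measurable [set w | X 0 w = i] by exact: mX.
rewrite (total_probability P (X 0)) ?(total_probability P (X 0) (_ `&` regime k));
  [|exact: measurableI|by []|exact: measurableI|by []].
rewrite mulr_suml; apply: eq_bigr => i _; rewrite -!(setIA _ (regime k)).
set D := regime k `&` _; have mD : measurable D by exact: measurableI.
(* Initial states of probability zero in this regime contribute 0 to both sides. *)
have [PD0|PD_neq0] := eqVneq (P D) 0%E.
  have null E : measurable E -> fine (P (E `&` D)) = 0.
    by move=> mE; apply: null_subset PD0 _ => //; exact: measurableI.
  by rewrite !null// mul0r.
case: (split_ordP i) => [j ij|j ij].
  have Dj : D = [set w | phi w = k] `&` at_state X 0 (transient j) by rewrite /D ij.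
  have := @mixture_markov _ _ _ _ _ _ _ _ _ _ _ X_mixture k j.
  rewrite /= -Dj => /(_ PD_neq0).
  move=> [_ [p semigroup_p]] /(_ s h x y A s_ge0 h_ge0 pastA).
  rewrite (semigroup_expmx _ _ semigroup_p)// /prob_given mulrAC.
  apply: mulIf; rewrite invr_eq0; apply: contra PD_neq0 => /eqP PD.
  by rewrite -(probability_fineK P D)// PD.
(* The remaining initial state is the absorbing one, which is null. *)
have [] := negP PD_neq0; apply/eqP; apply: subset_measure0 mD (mX0 i) _ _.
  exact: subIsetr.
by rewrite ij (_ : j = ord0) ?ord1//; exact: mixture_init_absorbing X_mixture.
Qed.

Lemma measurable_in_states (t : R) (G : {set 'I_(n + 1)}) :
  0 <= t -> measurable [set w | X t w \in G].
Proof.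
move=> t0; rewrite (_ : [set w | _] = \bigcup_(x in [set` G]) at_state X t x).
  by apply: fin_bigcup_measurable => // x _; exact: mX.
apply/seteqP; split => w; first by move=> Gw; exists (X t w).
by move=> [x /= Gx wx]; rewrite wx.
Qed.

Lemma measurable_notin_states (t : R) (G : {set 'I_(n + 1)}) :
  0 <= t -> measurable [set w | X t w \notin G].
Proof.
move=> t0; rewrite (_ : [set w | _] = ~` [set w | X t w \in G]).
  by apply: measurableC; exact: measurable_in_states.
by apply/seteqP; split => w /= => [/negP|/negP].
Qed.

Let pastT (t : R) : sigma_of X `[0, t] setT.
Proof.
rewrite -(setD0 setT); apply: sigma_algebraCD; exact: sigma_algebra0.
Qed.

(** Split by the states at both times and by the regime: each term with x in [G] and y outside
    carries a zero entry of the exponential. *)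
Lemma exit_null (G : {set 'I_(n + 1)}) (s t : R) :
  stochastically_closed Q G -> 0 <= s -> s <= t ->
  P ([set w | X s w \in G] `&` [set w | X t w \notin G]) = 0%E.
Proof.
move=> QG s_ge0 st; have t_ge0 : 0 <= t by exact: le_trans st.
set E := _ `&` _; have mE : measurable E.
  by apply: measurableI; [exact: measurable_in_states|exact: measurable_notin_states].
have mXs x : measurable [set w | X s w = x] by exact: mX.
have mXt x : measurable [set w | X t w = x] by exact: mX.
rewrite -(probability_fineK P E mE) (total_probability P (X s))// big1// => x _.
rewrite (total_probability P (X t)) ?big1//; last exact: measurableI.
move=> y _; case: (boolP ((x \in G) && (y \notin G))) => [/andP[xG yG]|xyG]; last first.
  rewrite (_ : _ `&` _ = set0) ?measure0//; apply/seteqP; split => // w [[[/= xG yG] wx] wy].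
  by move/negP: xyG; apply; rewrite -wx -wy xG.
have mxy : measurable (at_state X s x `&` at_state X t y) by apply: measurableI; exact: mX.
apply: (null_subset P _ (at_state X s x `&` at_state X t y)) => //; last first.
- by move=> w [[_ wx] wy].
- rewrite -(probability_fineK P)// (total_probability P phi)// big1// => k _.
  have := regime_markov k s (t - s) x y setT s_ge0; rewrite subr_ge0 => /(_ st (pastT s)).
  rewrite setTI subrKC => ->; rewrite (expmx_closed _ G) ?mulr0//.
  by move=> i j; exact: QG.
- by do 2 (apply: measurableI => //).
Qed.

(** The strict inequality rests on right-continuity: a path outside [G] up to t keeps its value on
    some [t, t + e[, so the infimum is at least t + e. *)
Lemma lt_hitting_timeP (G : {set 'I_(n + 1)}) (t : R) w : 0 <= t ->
  (t%:E < hitting_time X G w)%E <-> forall u, 0 <= u -> u <= t -> X u w \notin G.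
Proof.
move=> t0; split => [tG u u0 ut|noG].
  apply/negP => uG; move: tG; apply/negP; rewrite -leNgt.
  by apply: ge_ereal_inf; exists u%:E; [exists u|rewrite lee_fin].
have [e /= e0 Xe] := mixture_right_continuous X_mixture w t0.
apply: (@lt_le_trans _ _ (t + e)%:E); first by rewrite lte_fin ltrDl.
apply: le_ereal_inf_tmp => _ [u [u0 uG] <-]; rewrite lee_fin leNgt.
apply/negP => ute; have [ut|tu] := leP u t.
  by have := noG _ u0 ut; rewrite uG.
have := noG t t0 (lexx t); rewrite -(Xe u) ?uG//=.
by rewrite distrC gtr0_norm ?subr_gt0// ltrBlDl.
Qed.

(** An explicit measurable null set is produced so that the equality also yields the measurability
    of the hitting event. *)
Lemma survival_eq (G : {set 'I_(n + 1)}) (t : R) :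
  stochastically_closed Q G -> 0 <= t ->
  exists N, [/\ measurable N, P N = 0%E &
    [set w | (t%:E < hitting_time X G w)%E] = [set w | X t w \notin G] `\` N].
Proof.
move=> QG t0.
(* A visit to G before t contains a rational time, by right-continuity. *)
pose bad (r : rat) := if (0 : R) <= ratr r <= t then
  [set w | X (ratr r) w \in G] `&` [set w | X t w \notin G] else set0.
(* The rationals are enumerated by [unpickle]; numbers coding no rational contribute the empty
   set. *)
pose N := \bigcup_k (if unpickle k is Some r then bad r else set0).
have mbad r : measurable (bad r).
  rewrite /bad; case: ifPn => // /andP[r0 rt]; apply: measurableI.
    exact: measurable_in_states.
  exact: measurable_notin_states.
have mN k : measurable (if unpickle k is Some r then bad r else set0).
  by case: unpickle.
exists N; split; first exact: bigcupT_measurable.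
- apply/negligibleP; first exact: bigcupT_measurable.
  apply: negligible_bigcup => k; apply/negligibleP => //.
  case: unpickle => [r|]; last by rewrite measure0.
  rewrite /bad; case: ifPn => [/andP[r0 rt]|_]; last by rewrite measure0.
  exact: exit_null.
apply/seteqP; split => w /=.
  move/lt_hitting_timeP => /(_ t0) noG; split; first exact: noG.
  case=> k _; case: unpickle => // r; rewrite /bad; case: ifPn => // /andP[r0 rt].
  by case=> /= + _; apply/negP; exact: noG.
move=> [tG notN]; apply/lt_hitting_timeP => // u u0 ut; apply/negP => uG; apply: notN.
have [ut'|] := ltP u t; last first.
  by move=> tu; rewrite (@le_anti _ _ u t) ?ut// in uG; rewrite uG in tG.
have [e /= e0 Xe] := mixture_right_continuous X_mixture w u0.
have /rat_in_itvoo[r] : u < Num.min t (u + e) by rewrite lt_min ut' ltrDl e0.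
rewrite in_itv/= lt_min => /and3P[ur rt rue].
exists (pickle r); first exact: I.
rewrite pickleK /bad (ltW rt) (le_trans u0 (ltW ur))/=.
split => //=; rewrite (Xe (ratr r))//= distrC gtr0_norm ?subr_gt0//.
by rewrite ltrBlDl.
Qed.

Lemma joint_survival_eq (G1 G2 : {set 'I_(n + 1)}) (t1 t2 : R) :
  stochastically_closed Q G1 -> stochastically_closed Q G2 ->
  0 <= t1 -> 0 <= t2 -> exists N, [/\ measurable N, P N = 0%E &
    joint_survival X G1 G2 t1 t2 =
    ([set w | X t1 w \notin G1] `&` [set w | X t2 w \notin G2]) `\` N].
Proof.
move=> QG1 QG2 t10 t20.
have [N1 [mN1 N10 E1]] := survival_eq G1 t1 QG1 t10.
have [N2 [mN2 N20 E2]] := survival_eq G2 t2 QG2 t20.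
exists (N1 `|` N2); split; first exact: measurableU.
  by rewrite null_set_setU.
rewrite (_ : joint_survival _ _ _ _ _ = [set w | (t1%:E < hitting_time X G1 w)%E] `&`
  [set w | (t2%:E < hitting_time X G2 w)%E])// E1 E2.
by rewrite !setDE setCU setIACA.
Qed.

(** The Markov property is used from t to u, then from u to v. [G1] is tied to the earlier time, so
    that both orderings in the theorem are instances. *)
Lemma regime_survival (G1 G2 : {set 'I_(n + 1)}) k (t u v : R) x A :
  0 <= t -> t <= u -> u <= v -> sigma_of X `[0, t] A ->
  fine (P ([set w | X u w \notin G1] `&` [set w | X v w \notin G2] `&`
    (A `&` at_state X t x `&` regime k))) =
  fine (P (A `&` at_state X t x `&` regime k)) *
  \sum_(y | y \notin G1) \sum_(z | z \notin G2)
    expmx ((u - t) *: Q k) x y * expmx ((v - u) *: Q k) y z.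
Proof.
move=> t0 tu uv pastA; have u0 := le_trans t0 tu; have v0 := le_trans u0 uv.
have mA := closed_past_measurable _ _ pastA.
have mXu y : measurable [set w | X u w = y] by exact: mX.
have mXv y : measurable [set w | X v w = y] by exact: mX.
set B := A `&` _ `&` _; have mB : measurable B.
  by do 2 (apply: measurableI => //); exact: mX.
set E := _ `&` B; have mE : measurable E.
  by apply: measurableI => //; apply: measurableI; exact: measurable_notin_states.
rewrite (total_probability P (X u) E)// mulr_sumr [RHS]big_mkcond/=.
apply: eq_bigr => y _; have mEy : measurable (E `&` [set w | X u w = y]).
  exact: measurableI.
rewrite (total_probability P (X v) _ mEy)//.
case: ifPn => [yG|yG]; last first.
  rewrite big1// => z _; rewrite (_ : _ `&` _ = set0) ?measure0//.
  apply/seteqP; split => // w [[[[/= uG _] _] uy] _]; move: yG.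
  by rewrite -uy uG.
rewrite mulr_sumr [RHS]big_mkcond/=; apply: eq_bigr => z _.
case: ifPn => [zG|zG]; last first.
  rewrite (_ : _ `&` _ = set0) ?measure0//.
  apply/seteqP; split => // w [[[[/= _ vG] _] _] vz]; move: zG.
  by rewrite -vz vG.
(* For the second transition, the position at t is part of the past of u. *)
have pastAx : sigma_of X `[0, u] (A `&` at_state X t x).
  apply: (@measurableI _ (g_sigma_algebraType _) A (at_state X t x)).
    apply: past_le pastA => w /=; rewrite !in_itv/= => /andP[-> /le_trans ->//].
  apply: sub_sigma_algebra; exists t; last by exists x.
  by rewrite /= in_itv/= t0.
have := regime_markov k u (v - u) y z _ u0 _ pastAx; rewrite subr_ge0 => /(_ uv).
have := regime_markov k t (u - t) x y _ t0 _ pastA; rewrite subr_ge0 => /(_ tu).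
rewrite !subrKC mulrA => <- <-; congr (fine (P _)).
apply/seteqP; split => w /=.
  by move=> [[[_ [[Aw wx] wk]] wy] wz].
move=> [[[Awx wy] wz] wk]; split=> //; split=> //; split; last by split.
by split; rewrite /= ?(wy : X u w = y) ?(wz : X v w = z).
Qed.

End Regimes.

(** As the closed sets contain the absorbing state, the sums run over transient states only, where
    the diagonal matrices act as indicators. *)
Lemma survival_form_mx {R : realType} {n : nat} (B : 'M[R]_n)
    (G1 G2 : {set 'I_(n + 1)}) (a b : R) i :
  absorbing \in G1 -> absorbing \in G2 ->
  \sum_(y | y \notin G1) \sum_(z | z \notin G2)
    expmx (a *: intensity_of B) (transient i) y * expmx (b *: intensity_of B) y z =
  ((delta_mx 0 i : 'rV[R]_n) *m expmx (a *: B) *m survival_mx G1 *m expmx (b *: B) *m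
    survival_mx G2 *m (const_mx 1 : 'cV[R]_n)) 0 0.
Proof.
move=> aG1 aG2; have split_sum (G : {set 'I_(n + 1)}) (f : 'I_(n + 1) -> R) :
    absorbing \in G ->
    \sum_(y | y \notin G) f y = \sum_j (transient j \notin G)%:R * f (transient j).
  move=> aG; rewrite big_mkcond big_split_ord/= [X in _ + X]big1 ?addr0.
    apply: eq_bigr => j _; rewrite -/(transient j).
    by case: (transient j \notin G); rewrite ?mul1r ?mul0r.
  by move=> j _; rewrite ord1 -/absorbing aG.
(* Abstracting both exponentials keeps [mxE] from unfolding them into series. *)
have := expmx_intensity_of B a; have := expmx_intensity_of B b.
move: (expmx (a *: B)) (expmx (b *: B)) => Ea Eb EbE EaE.
rewrite split_sum// -!mulmxA -rowE mxE mxE; apply: eq_bigr => j _.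
rewrite split_sum// EaE /survival_mx mul_diag_mx 2!mxE mulrCA mxE.
congr (_ * _); rewrite mulr_sumr; apply: eq_bigr => l _.
by rewrite EbE mul_diag_mx !mxE mulr1 mulrCA [X in _ * X]mulrC.
Qed.

(** * Conditional probabilities *)

Section CombineConditional.
Context {R : realType} {d : measure_display} {Omega : measurableType d}.
Variables (P : probability Omega R) (F : set (set Omega)).
Hypothesis F_sigma : sigma_algebra setT F.
Hypothesis F_measurable : F `<=` measurable.

Let measurable_F (f : Omega -> R) : (forall Y, measurable Y -> F (f @^-1` Y)) ->
  measurable_fun setT (f : g_sigma_algebraType F -> R).
Proof.
by move=> Ff _ Y mY; rewrite setTI; apply: sub_sigma_algebra; exact: Ff.
Qed.

(** The sets where g >= 0 and where g <= 0 belong to [F]; on each, the integral of |g| is that of g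
    up to sign, hence 0. *)
Lemma ae_eq0_integral (g : Omega -> R) :
  measurable_fun setT (g : g_sigma_algebraType F -> R) ->
  P.-integrable setT (EFin \o g) ->
  (forall C, F C -> (\int[P]_(w in C) (g w)%:E)%E = 0%E) ->
  {ae P, forall w, g w = 0}.
Proof.
move=> mg ig g0; have FE A : @measurable _ (g_sigma_algebraType F) A -> F A.
  by rewrite -[in X in _ -> X](sigma_algebra_id F_sigma).
have [iP iN] : F (g @^-1` `[0, +oo[) /\ F (g @^-1` `]-oo, 0]).
  by split; apply: FE; rewrite -[X in measurable X]setTI; apply: mg => //; exact: measurable_itv.
have aeC C : F C -> (\int[P]_(w in C) `|(g w)%:E|)%E = 0%E ->
    {ae P, forall w, C w -> g w = 0}.
  move=> FC C0; have mC := F_measurable _ FC.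
  have : ae_eq P C (EFin \o g) (cst 0%E).
    apply/ae_eq_integral_abs => //.
    have iC : P.-integrable C (EFin \o g) by exact: integrableS ig.
    exact: measurable_int iC.
  by apply: filterS => w /[apply] -[].
have := aeC _ iP; have := aeC _ iN => /= aeN aeP.
have {}aeP : {ae P, forall w, g w \in `[0, +oo[ -> g w = 0}.
  apply: aeP; rewrite -[RHS](g0 _ iP); apply: eq_integral => w; rewrite inE/= in_itv/= andbT => gw.
  by rewrite ger0_norm.
have {}aeN : {ae P, forall w, g w \in `]-oo, 0] -> g w = 0}.
  apply: aeN; under eq_integral => w.
    rewrite inE/= in_itv/= => gw; rewrite ler0_norm// EFinN -mulN1e -EFinN; over.
  rewrite integralZl ?g0 ?mule0//; first exact: F_measurable.
  by apply: integrableS ig => //; exact: F_measurable.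
apply: filterS2 aeP aeN => w gP gN; have [g_ge0|g_lt0] := leP 0 (g w).
  by apply: gP; rewrite in_itv/= g_ge0.
by apply: gN; rewrite in_itv/= ltW.
Qed.

(** The difference of the two sides is measurable for [F] and integrates to 0 over every set of
    [F]. *)
Lemma cond_prob_combination {m : nat} (A : set Omega) (a : Omega -> R)
    (E : 'I_m -> set Omega) (b : 'I_m -> Omega -> R) (v : 'I_m -> R) :
  measurable A -> (forall k, measurable (E k)) ->
  is_cond_prob P F A a -> (forall k, is_cond_prob P F (E k) (b k)) ->
  (forall C, F C -> fine (P (A `&` C)) = \sum_k fine (P (E k `&` C)) * v k) ->
  {ae P, forall w, a w = \sum_k b k w * v k}.
Proof.
move=> mA mE [Fa ia aP] bE AE.
pose s w := \sum_k v k * b k w.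
have ib : P.-integrable setT (EFin \o s).
  rewrite (_ : EFin \o s = fun w => (\sum_k ((v k)%:E * (b k w)%:E))%E).
    apply: integrable_sum => // k _; apply: integrableZl => //.
    by case: (bE k).
  by apply/funext => w; rewrite /= /s -sumEFin.
suff : {ae P, forall w, a w - s w = 0}.
  apply: filterS => w /subr0_eq ->; apply: eq_bigr => k _; exact: mulrC.
apply: ae_eq0_integral.
- apply: measurable_funB; first exact: measurable_F.
  apply: measurable_sum => k; apply: measurable_funM; first exact: measurable_cst.
  by apply: measurable_F; case: (bE k).
- rewrite (_ : EFin \o _ = ((EFin \o a) \- (EFin \o s))%E)//.
  exact: integrableB.
move=> C FC; have mC := F_measurable _ FC.
rewrite (_ : (fun w => _) = (fun w => (a w)%:E - (s w)%:E)%E)//.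
have iaC : P.-integrable C (EFin \o a) by exact: integrableS ia.
have isC : P.-integrable C (EFin \o s) by exact: integrableS ib.
rewrite integralB_EFin// aP//.
have -> : (\int[P]_(w in C) (s w)%:E)%E = (\sum_k (v k)%:E * P (E k `&` C))%E.
  under eq_integral do rewrite -sumEFin.
  rewrite integral_sum//.
    apply: eq_bigr => k _; have [_ ibk <-//] := bE k.
    under eq_integral do rewrite EFinM.
    by rewrite integralZl//; exact: integrableS ibk.
  move=> k; under eq_fun do rewrite EFinM.
  by apply: integrableZl => //; have [_ ibk _] := bE k; exact: integrableS ibk.
rewrite -(probability_fineK P (A `&` C)); last exact: measurableI.
under eq_bigr do rewrite -(probability_fineK P _ (measurableI _ _ (mE _) mC)) -EFinM mulrC.
by rewrite sumEFin -EFinB AE// subrr.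
Qed.

End CombineConditional.

(** * Versions of the survival probability at a fixed time and state *)

Section SurvivalVersion.
Context {R : realType} {d : measure_display} {Omega : measurableType d}.
Context {n m : nat}.
Variables (P : probability Omega R) (X : R -> Omega -> 'I_(n + 1)).
Variables (phi : Omega -> 'I_m) (pi : 'I_n -> R) (s0 : 'I_m -> 'I_n -> R).
Variable B : 'I_m -> 'M[R]_n.
Hypothesis X_mixture : markov_mixture P X phi pi s0 (fun k => intensity_of (B k)).
Variables (t : R) (F : set (set Omega)) (i : 'I_n).
Hypothesis t0 : 0 <= t.
Hypothesis F_sigma : sigma_algebra setT F.
Hypothesis F_past : F `<=` sigma_of X `[0, t[.
Variables (q : Omega -> R) (s : 'I_m -> Omega -> R).
Hypothesis s_version : forall k,
  is_cond_prob_on P F (at_state X t (transient i)) q [set w | phi w = k] (s k).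

Let D := at_state X t (transient i).

Let mD : measurable D.
Proof. exact: mixture_measurable_state X_mixture _ _ t0. Qed.

Let mphi k : measurable [set w | phi w = k].
Proof. exact: mixture_measurable_regime X_mixture k. Qed.

Let F_measurable : F `<=` measurable.
Proof.
apply: subset_trans F_past _; apply: (past_measurable P X phi pi s0 _ X_mixture).
by move=> u /=; rewrite in_itv/= => /andP[].
Qed.

Let F_closed_past : F `<=` sigma_of X `[0, t].
Proof.
apply: subset_trans F_past _; apply: past_le => u /=.
by rewrite !in_itv/= => /andP[-> /ltW].
Qed.

(** Within regime k, [A] has conditional weight [v k] whatever the past event [C]. The versions then
    combine linearly, and dividing by [q] turns the joint versions into the weights [s k]. *)
Lemma regime_combination (A : set Omega) (a : Omega -> R) (v : 'I_m -> R) :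
  measurable A -> is_cond_prob P F (A `&` D) a ->
  (forall C k, F C ->
    fine (P (A `&` (C `&` D `&` [set w | phi w = k]))) =
    fine (P (C `&` D `&` [set w | phi w = k])) * v k) ->
  {ae P, forall w, 0 < q w -> a w / q w = \sum_k s k w * v k}.
Proof.
move=> mA aA Av.
have /choice[b bP] : forall k, exists b, is_cond_prob P F ([set w | phi w = k] `&` D) b /\
    {ae P, forall w, 0 < q w -> s k w = b w / q w}.
  by move=> k; have [b] := s_version k; exists b.
(* Finitely many regimes: one null set serves them all. *)
have sb : {ae P, forall w, forall k, 0 < q w -> s k w = b k w / q w}.
  by apply: filter_forall => k; have [] := bP k.
have ab : {ae P, forall w, a w = \sum_k b k w * v k}.
  apply: (cond_prob_combination P F F_sigma F_measurable (A `&` D) a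
    (fun k => [set w | phi w = k] `&` D)) => //.
  - exact: measurableI.
  - by move=> k; exact: measurableI.
  - by move=> k; have [] := bP k.
  move=> C FC; have mC := F_measurable _ FC.
  rewrite (total_probability P phi)//; last by do 2 (apply: measurableI => //).
  apply: eq_bigr => k _.
  rewrite (_ : [set w | phi w = k] `&` D `&` C = C `&` D `&` [set w | phi w = k]).
    by rewrite -Av// [C `&` D]setIC !setIA.
  by rewrite -setIA setIC [D `&` C]setIC.
apply: filterS2 sb ab => w sb ab q0; rewrite ab mulr_suml.
by apply: eq_bigr => k _; rewrite sb// mulrAC.
Qed.

Lemma survival_version (G1 G2 : {set 'I_(n + 1)}) (u v : R) (J N : set Omega)
    (f : Omega -> R) :
  absorbing \in G1 -> absorbing \in G2 -> t <= u -> u <= v ->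
  measurable N -> P N = 0%E ->
  J = ([set w | X u w \notin G1] `&` [set w | X v w \notin G2]) `\` N ->
  is_cond_prob_on P F D q J f ->
  {ae P, forall w, 0 < q w -> f w =
    \sum_k s k w * ((delta_mx 0 i : 'rV[R]_n) *m expmx ((u - t) *: B k) *m
      survival_mx G1 *m expmx ((v - u) *: B k) *m survival_mx G2 *m
      (const_mx 1 : 'cV[R]_n)) 0 0}.
Proof.
move=> aG1 aG2 tu uv mN N0 JE [a aJ fa].
have u0 := le_trans t0 tu; have v0 := le_trans u0 uv.
set K := _ `&` _ in JE; have mK : measurable K.
  by apply: measurableI; exact: (measurable_notin_states P X phi pi s0 _ X_mixture).
have mJ : measurable J by rewrite JE; exact: measurableD.
apply: filterS2 fa (regime_combination J a (fun k =>
  ((delta_mx 0 i : 'rV[R]_n) *m expmx ((u - t) *: B k) *m survival_mx G1 *m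
  expmx ((v - u) *: B k) *m survival_mx G2 *m (const_mx 1 : 'cV[R]_n)) 0 0) mJ aJ _).
  by move=> w fa aw q0; rewrite fa// aw.
move=> C k FC; have mC := F_measurable _ FC.
have mCDk : measurable (C `&` D `&` [set w | phi w = k]).
  by do 2 (apply: measurableI => //).
rewrite -survival_form_mx//.
rewrite -(regime_survival P X phi pi s0 _ X_mixture _ _ k t u v _ C t0 tu uv); last first.
  exact: F_closed_past.
congr (fine _); set E := C `&` D `&` _.
have mKE : measurable (K `&` E) by exact: measurableI.
(* Removing the null set [N] does not change the probability. *)
rewrite [RHS](measureDI P mKE mN) [X in (_ + X)%E](_ : _ = 0%E) ?adde0; last first.
  by apply: (subset_measure0 _ mN _ N0); [exact: measurableI|exact: subIsetr].
by rewrite JE; congr (P _); rewrite !setDE setIAC.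
Qed.

(** Take the sure event with every [v k] equal to 1: then [q] is itself the version a, and q / q = 1
    where [q] is positive. *)
Lemma weights_sum : is_cond_prob P F D q ->
  {ae P, forall w, 0 < q w -> \sum_k s k w = 1}.
Proof.
move=> qP; have := regime_combination setT q (fun=> 1) (@measurableT _ _).
rewrite setTI => /(_ qP) H; apply: filterS (H _) => [w qs q0|C k FC].
  by under eq_bigr do rewrite -[s _ _]mulr1; rewrite -qs// divff// gt_eqF.
by rewrite setTI mulr1.
Qed.

End SurvivalVersion.

(** * The two orderings of the times and the sum of the weights *)

Theorem lemma3p7 (R : realType) (d : measure_display) (Omega : measurableType d)
    (P : probability Omega R) (n m : nat)
    (B : 'I_m -> 'M[R]_n) (pi : 'I_n -> R) (s0 : 'I_m -> 'I_n -> R)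
    (X : R -> Omega -> 'I_(n + 1)) (phi : Omega -> 'I_m)
    (Gamma1 Gamma2 : {set 'I_(n + 1)})
    (F : R -> set (set Omega))
    (q : R -> 'I_n -> Omega -> R)
    (s : R -> 'I_m -> 'I_n -> Omega -> R)
    (Fbar : 'I_n -> R -> R -> R -> Omega -> R)
    (B_nonsingular : forall k, B k \in unitmx)
    (Q_intensity : forall k, is_intensity (intensity_of (B k)))
    (X_mixture : markov_mixture P X phi pi s0 (fun k => intensity_of (B k)))
    (Gamma1_closed : stochastically_closed (fun k => intensity_of (B k)) Gamma1)
    (Gamma2_closed : stochastically_closed (fun k => intensity_of (B k)) Gamma2)
    (Gamma12 : (Gamma1 :&: Gamma2 = [set absorbing])%SET)
    (pi_neq0 : forall i, transient i \notin Gamma1 ->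
      transient i \notin Gamma2 -> pi i != 0)
    (start_alive : P (joint_survival X Gamma1 Gamma2 0 0) = 1%E)
    (* F t is the information strictly before t *)
    (F_sigma : forall t, 0 <= t -> sigma_algebra setT (F t))
    (F_past : forall t, 0 <= t -> F t `<=` sigma_of X `[0, t[)
    (* q t i is a version of P{X_t = i | F t} *)
    (q_version : forall t i, 0 <= t ->
      is_cond_prob P (F t) (at_state X t (transient i)) (q t i))
    (* s t k i is a version of P{phi = k | F t, X_t = i}, completed to weights *)
    (s_version : forall t k i, 0 <= t ->
      is_cond_prob_on P (F t) (at_state X t (transient i)) (q t i)
        [set w | phi w = k] (s t k i))
    (s_completed : forall t i w, 0 <= t -> ~~ (0 < q t i w) ->
      (forall k, 0 <= s t k i w) /\ \sum_k s t k i w = 1)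
    (* Fbar i t t1 t2 is a version of P{tau1 > t1, tau2 > t2 | F t, X_t = i} *)
    (Fbar_version : forall i t t1 t2, 0 <= t -> t <= t1 -> t <= t2 ->
      is_cond_prob_on P (F t) (at_state X t (transient i)) (q t i)
        (joint_survival X Gamma1 Gamma2 t1 t2) (Fbar i t t1 t2)) :
  let S (k : 'I_m) (t : R) (w : Omega) : 'M[R]_n := diag_mx (\row_i s t k i w) in
  let H1 : 'M[R]_n := survival_mx Gamma1 in
  let H2 : 'M[R]_n := survival_mx Gamma2 in
  let e (i : 'I_n) : 'rV[R]_n := delta_mx 0 i in
  let one : 'cV[R]_n := const_mx 1 in
  (forall (i : 'I_n) (t t1 t2 : R), 0 <= t -> t <= t2 -> t2 <= t1 ->
    {ae P, forall w, 0 < q t i w ->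
      Fbar i t t1 t2 w =
      \sum_k (e i *m S k t w *m expmx ((t2 - t) *: B k) *m H2
                *m expmx ((t1 - t2) *: B k) *m H1 *m one) 0 0}) /\
  (forall (i : 'I_n) (t t1 t2 : R), 0 <= t -> t <= t1 -> t1 <= t2 ->
    {ae P, forall w, 0 < q t i w ->
      Fbar i t t1 t2 w =
      \sum_k (e i *m S k t w *m expmx ((t1 - t) *: B k) *m H1
                *m expmx ((t2 - t1) *: B k) *m H2 *m one) 0 0}) /\
  (forall t : R, 0 <= t -> {ae P, forall w, \sum_k S k t w = 1%:M}).
Proof.
move=> S H1 H2 e one.
have [aG1 aG2] : absorbing \in Gamma1 /\ absorbing \in Gamma2.
  by apply/andP; rewrite -finset.in_setI Gamma12 finset.set11.
(* The row e_i S^(k)(t) is the scalar s_i^(k)(t) times e_i, so the weight factors out. *)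
have row_weight (u1 u2 t : R) k i w (G G' : {set 'I_(n + 1)}) :
    (e i *m S k t w *m expmx (u1 *: B k) *m survival_mx G *m
      expmx (u2 *: B k) *m survival_mx G' *m one) 0 0 =
    s t k i w * (e i *m expmx (u1 *: B k) *m survival_mx G *m
      expmx (u2 *: B k) *m survival_mx G' *m one) 0 0.
  rewrite (_ : e i *m S k t w = s t k i w *: e i).
    by rewrite -!scalemxAl mxE.
  by rewrite -rowE row_diag_mx mxE.
split; [|split].
- move=> i t t1 t2 t0 tt2 t21.
  have t2_ge0 := le_trans t0 tt2; have t1_ge0 := le_trans t2_ge0 t21.
  have [N [mN N0 JE]] := joint_survival_eq P X phi pi s0 _ X_mixture _ _ t1 t2
    Gamma1_closed Gamma2_closed t1_ge0 t2_ge0.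
  (* The earlier time is t2 here, so its event comes first and [Gamma2] takes the role of [G1]. *)
  rewrite [X in X `\` N]setIC in JE.
  have := survival_version P X phi pi s0 B X_mixture t (F t) i t0 (F_sigma t t0)
    (F_past t t0) (q t i) (fun k => s t k i) (fun k => s_version t k i t0)
    Gamma2 Gamma1 t2 t1 _ N _ aG2 aG1 tt2 t21 mN N0 JE
    (Fbar_version i t t1 t2 t0 (le_trans tt2 t21) tt2).
  apply: filterS => w /[apply] ->; apply: eq_bigr => k _.
  exact/esym/row_weight.
- move=> i t t1 t2 t0 tt1 t12.
  have t1_ge0 := le_trans t0 tt1; have t2_ge0 := le_trans t1_ge0 t12.
  have [N [mN N0 JE]] := joint_survival_eq P X phi pi s0 _ X_mixture _ _ t1 t2
    Gamma1_closed Gamma2_closed t1_ge0 t2_ge0.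
  have := survival_version P X phi pi s0 B X_mixture t (F t) i t0 (F_sigma t t0)
    (F_past t t0) (q t i) (fun k => s t k i) (fun k => s_version t k i t0)
    Gamma1 Gamma2 t1 t2 _ N _ aG1 aG2 tt1 t12 mN N0 JE
    (Fbar_version i t t1 t2 t0 tt1 (le_trans tt1 t12)).
  apply: filterS => w /[apply] ->; apply: eq_bigr => k _.
  exact/esym/row_weight.
- move=> t t0; have sum1 : {ae P, forall w, forall i, \sum_k s t k i w = 1}.
    apply: filter_forall => i.
    have := weights_sum P X phi pi s0 B X_mixture t (F t) i t0 (F_sigma t t0)
      (F_past t t0) (q t i) (fun k => s t k i) (fun k => s_version t k i t0)
      (q_version t i t0).
    (* Where [q] is not positive, the sum is 1 by the chosen completion of the weights. *)
    apply: filterS => w qs; have [/qs//|q0] := boolP (0 < q t i w).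
    by have [] := s_completed t i w t0 q0.
  apply: filterS sum1 => w sum1; apply/matrixP => i j; rewrite summxE mxE -(sum1 i) -sumrMnl.
  by apply: eq_bigr => k _; rewrite !mxE.
Qed.
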